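(* Let $n\ge 2$ and let $f\in C_n$ be a cosine polynomial that does not have a double root. Then there exists $\bar f\in C_n$ having at least one double root such that $v(f)>v(\bar f)$.
   Context: For an integer $n\ge 2$, $C_n$ denotes the set of real cosine polynomials $f(\phi)=\sum_{k=0}^{n} a_k\cos(k\phi)$ such that (i) all coefficients $a_0,\dots,a_n$ are real and nonnegative, (ii) $a_1>a_0>0$, and (iii) $f(\phi)\ge 0$ for all real $\phi$. For $f\in C_n$ with coefficients $a_k$, $v(f)=\dfrac{f(0)-a_0}{(\sqrt{a_1}-\sqrt{a_0})^2}$. Every cosine polynomial $f$ of degree at most $n$ can be written as $f(\phi)=h(\cos\phi)$ for a unique real algebraic polynomial $h$ of degree at most $n$; a double root of $f$ means a point $x_0\in[-1,1]$ that is a zero of $h$ of multiplicity at least $2$. *)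

(* Defs.v *)
From mathcomp Require Import all_boot all_order all_algebra.
From mathcomp Require Import all_classical all_reals all_analysis.

Set Implicit Arguments.
Unset Strict Implicit.
Unset Printing Implicit Defensive.

Import Order.TTheory GRing.Theory Num.Theory.
Local Open Scope ring_scope.

(* A cosine polynomial of degree at most n is given by its coefficients
   a_0, ..., a_n, which the function determines. *)
Definition cospoly (R : realType) (n : nat) (a : 'I_n.+1 -> R) (phi : R) : R :=
  \sum_(k < n.+1) a k * cos (k%:R * phi).

(* [inord 1] is the index 1 as soon as 1 <= n; C_n is only used for n >= 2. *)
Record inC (R : realType) (n : nat) (a : 'I_n.+1 -> R) : Prop := InC {
  inC_coef_ge0 : forall k, 0 <= a k;
  inC_a0_gt0 : 0 < a ord0;
  inC_a0_lt_a1 : a ord0 < a (inord 1);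
  inC_ge0 : forall phi : R, 0 <= cospoly a phi }.

Definition vfun (R : realType) (n : nat) (a : 'I_n.+1 -> R) : R :=
  (cospoly a 0 - a ord0) / (Num.sqrt (a (inord 1)) - Num.sqrt (a ord0)) ^+ 2.

(* h is the polynomial of degree at most n with f(phi) = h(cos phi); it exists
   and is unique by [algebraic_form_exists] and [algebraic_form_unique]. *)
Definition algebraic_form (R : realType) (n : nat) (a : 'I_n.+1 -> R)
    (h : {poly R}) : Prop :=
  (size h <= n.+1)%N /\ forall phi : R, cospoly a phi = h.[cos phi].

(* [mup x0 0 = 0] by convention, but h != 0 for the members of C_n, since
   h(1) = a_0 + ... + a_n > 0. *)
Definition double_root (R : realType) (n : nat) (a : 'I_n.+1 -> R) (x0 : R) :
    Prop :=
  -1 <= x0 <= 1 /\ exists h : {poly R}, algebraic_form a h /\ (2 <= mup x0 h)%N.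

Definition has_double_root (R : realType) (n : nat) (a : 'I_n.+1 -> R) : Prop :=
  exists x0 : R, double_root a x0.

Lemma cos_mul_poly (R : realType) (k : nat) :
  exists t : {poly R},
    (size t <= k.+1)%N /\ forall phi : R, cos (k%:R * phi) = t.[cos phi].
Proof.
suff [] : (exists t : {poly R}, (size t <= k.+1)%N /\
      forall phi : R, cos (k%:R * phi) = t.[cos phi]) /\
    (exists t : {poly R}, (size t <= k.+2)%N /\
      forall phi : R, cos (k.+1%:R * phi) = t.[cos phi]) by [].
elim: k => [|k [[t [st tE]] [u [su uE]]]].
  split.
    exists 1; split; first by rewrite size_poly1.
    by move=> phi; rewrite mul0r cos0 hornerC.
  exists 'X; split; first by rewrite size_polyX.
  by move=> phi; rewrite mul1r hornerX.
split; first by exists u.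
exists ('X * u *+ 2 - t); split.
  apply: (leq_trans (size_polyD _ _)); rewrite size_polyN geq_max.
  rewrite (leq_trans st) ?andbT; last by rewrite ltnW.
  rewrite mulr2n; apply: (leq_trans (size_polyD _ _)); rewrite maxnn.
  apply: (leq_trans (size_polyMleq _ _)); rewrite size_polyX.
  by rewrite addnC addn2.
move=> phi; rewrite hornerD hornerN hornerMn hornerM hornerX -tE -uE.
have -> : k.+2%:R * phi = k.+1%:R * phi + phi by rewrite -[k.+2]addn1 natrD mulrDl mul1r.
have -> : k%:R * phi = k.+1%:R * phi - phi.
  by rewrite -[k.+1]addn1 natrD mulrDl mul1r addrK.
by rewrite cosD cosB mulr2n [cos phi * _]mulrC opprD addrA addrK.
Qed.

Lemma algebraic_form_exists (R : realType) (n : nat) (a : 'I_n.+1 -> R) :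
  exists h : {poly R}, algebraic_form a h.
Proof.
have [T TP] := choice (@cos_mul_poly R).
exists (\sum_(k < n.+1) a k *: T k); split.
  apply: (leq_trans (size_sum _ _ _)); apply/bigmax_leqP => k _.
  apply: (leq_trans (size_scale_leq _ _)).
  by apply: leq_trans (TP k).1 _.
move=> phi; rewrite horner_sum; apply: eq_bigr => k _.
by rewrite hornerZ -(TP k).2.
Qed.

Lemma algebraic_form_unique (R : realType) (n : nat) (a : 'I_n.+1 -> R)
    (h1 h2 : {poly R}) :
  algebraic_form a h1 -> algebraic_form a h2 -> h1 = h2.
Proof.
move=> [_ E1] [_ E2]; apply/eqP; rewrite -subr_eq0; apply/negPn/negP => d0.
set d := h1 - h2 in d0.
pose s := [seq (k.+1%:R)^-1 : R | k <- iota 0 (size d)].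
suff : (size s < size d)%N by rewrite size_map size_iota ltnn.
apply: max_poly_roots => //.
  apply/allP => _ /mapP[k _ ->].
  have /acosK <- : (k.+1%:R^-1 : R) \in `[(-1), 1].
    rewrite in_itv /= invf_le1 ?ltr0Sn // ler1n andbT.
    by apply: (@le_trans _ _ 0); rewrite ?lerN10 // invr_ge0.
  by rewrite rootE /d hornerD hornerN -E1 -E2 subrr.
rewrite map_inj_uniq ?iota_uniq // => i j /invr_inj /eqP.
by rewrite eqr_nat => /eqP[].
Qed.

(* Main.v *)
(* Subtract t (1 + cos phi) from f with t as large as nonnegativity allows.  On
   the algebraic side h(x) - t (1 + x) then touches 0 at some point of [-1, 1]:
   an interior zero of a nonnegative polynomial is double, a contact at -1 is
   double because 1 + x already vanishes there, and 1 is no zero since f(0) is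
   a sum of nonnegative coefficients, not all zero.  Lowering a_0 and a_1 by
   the same t > 0 decreases f(0) - a_0 by t and increases sqrt a_1 - sqrt a_0,
   so v decreases; t = 0 would make f itself have a double root. *)
Require Import Defs.
From mathcomp Require Import all_boot all_order all_algebra.
From mathcomp Require Import all_classical all_reals all_analysis.
From mathcomp Require Import lra ring.
Import Order.TTheory GRing.Theory Num.Theory.
Import numFieldNormedType.Exports.
Local Open Scope ring_scope.

(** * Equispaced sampling and the constant coefficient *)

Lemma sum_cos_equispaced (R : realType) (N k : nat) : (0 < k < N)%N ->
  \sum_(0 <= j < N) cos (k%:R * (j%:R * (pi *+ 2 / N%:R))) = 0 :> R.
Proof.
move=> /andP[k0 kN].
have N1 : (0 < N)%N := ltn_trans k0 kN.
have N0 : 0 < N%:R :> R by rewrite ltr0n.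
pose t : R := pi * (k%:R / N%:R).
have st : 0 < sin t.
  apply: sin_gt0_pi; rewrite /t mulr_gt0 ?pi_gt0 ?divr_gt0 ?ltr0n //=.
  by rewrite gtr_pMr ?pi_gt0 // ltr_pdivrMr // mul1r ltr_nat.
(* The factor [2 * sin t] makes the sum telescope; it is nonzero because [0 < k < N] puts [t]
   strictly between [0] and [pi]. *)
apply/eqP; suff: 2 * sin t * \sum_(0 <= j < N)
    cos (k%:R * (j%:R * (pi *+ 2 / N%:R))) == 0.
  by rewrite !mulf_eq0 pnatr_eq0 (gt_eqF st).
rewrite big_distrr /=.
rewrite (@telescope_sumr_eq _ 0 N (fun j : nat => sin (j%:R * (t *+ 2) - t))) //.
  rewrite mul0r add0r.
  have -> : N%:R * (t *+ 2) = pi *+ 2 *+ k by rewrite /t; field; rewrite lt0r_neq0.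
  by rewrite [_ *+ k - t]addrC (periodicn (@sinD2pi R)) subrr.
move=> j _.
have -> : k%:R * (j%:R * (pi *+ 2 / N%:R)) = j%:R * (t *+ 2).
  by rewrite /t; ring.
have -> : j.+1%:R * (t *+ 2) - t = j%:R * (t *+ 2) + t.
  by rewrite -[j.+1]addn1 natrD; ring.
by rewrite sinD sinB; ring.
Qed.

(* Averaging over the points 2 pi j / (n+1) kills every frequency from 1 to n. *)
Lemma mean_cospoly (R : realType) (n : nat) (a : 'I_n.+1 -> R) :
  \sum_(0 <= j < n.+1) cospoly a (j%:R * (pi *+ 2 / n.+1%:R)) =
    n.+1%:R * a ord0.
Proof.
rewrite /cospoly exchange_big /= (bigD1 ord0) //= [X in _ + X]big1.
  rewrite addr0 -big_distrr /= mulrC; congr (_ * _).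
  under eq_bigr do rewrite mul0r cos0.
  by rewrite sumr_const_nat subn0.
move=> k k0; rewrite -big_distrr /= sum_cos_equispaced ?mulr0 //.
by rewrite ltn_ord andbT lt0n.
Qed.

Lemma cospoly_at0 (R : realType) (n : nat) (a : 'I_n.+1 -> R) :
  cospoly a 0 = \sum_k a k.
Proof. by apply: eq_bigr => k _; rewrite mulr0 cos0 mulr1. Qed.

(** The equispaced samples are nonnegative with mean [a ord0], and the sample at [0] is positive. *)
Lemma cospoly_const_gt0 (R : realType) (n : nat) (a : 'I_n.+1 -> R) :
  (forall phi, 0 <= cospoly a phi) -> 0 < cospoly a 0 -> 0 < a ord0.
Proof.
move=> age0 a0; rewrite -(@pmulr_rgt0 _ n.+1%:R) ?ltr0Sn // -mean_cospoly.
rewrite big_nat_recl // mul0r ltr_pwDl //.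
by apply: sumr_ge0.
Qed.

(** * Contact points of nonnegative polynomials on [[-1, 1]] *)

Lemma interior_min_zero_double (R : realType) (h : {poly R}) (x : R) :
  (forall y : R, -1 <= y <= 1 -> 0 <= h.[y]) -> -1 < x < 1 -> h.[x] = 0 ->
  ('X - x%:P) ^+ 2 %| h.
Proof.
move=> hge0 xI hx.
have hmin : is_derive x 1 (horner h) 0.
  apply: (@derive1_at_min R (horner h) (-1) 1) => // y.
  by rewrite in_itv /= hx => yI; apply: hge0; lra.
have dh : h^`().[x] = 0 by rewrite derivE derive1E derive_val.
(* For [h = q * ('X - x%:P)] the derivative at [x] is [q.[x]], which therefore vanishes. *)
have /factor_theorem [q hq] : root h x by rewrite rootE hx.
have qx : root q x.
  move: dh; rewrite hq derivM derivXsubC mulr1 hornerD hornerM hornerXsubC.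
  by rewrite subrr mulr0 add0r rootE => ->.
by rewrite hq expr2 dvdp_mul // dvdp_XsubCl.
Qed.

(* [t] is the largest value keeping h - t (1 + X) nonnegative on [-1, 1]; the
   contact point [x = 1] is excluded later, from the coefficients. *)
Lemma sub_multiple_1X_touch (R : realType) (h : {poly R}) :
  0 <= h.[-1] -> (forall y : R, -1 < y <= 1 -> 0 < h.[y]) ->
  exists t x : R, [/\ 0 <= t, -1 <= x <= 1,
    forall y : R, -1 <= y <= 1 -> 0 <= (h - t *: (1 + 'X)).[y],
    root (h - t *: (1 + 'X)) x &
    x = 1 \/ ('X - x%:P) ^+ 2 %| h - t *: (1 + 'X)].
Proof.
move=> hN1 hgt0.
(* Interior contacts are automatically double and [x = 1] is allowed, so multiplicity has to be
   checked only at [-1]. *)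
suff [t [x [t0 xI gge0 gx gN1]]] : exists t x : R, [/\ 0 <= t, -1 <= x <= 1,
    forall y : R, -1 <= y <= 1 -> 0 <= (h - t *: (1 + 'X)).[y],
    root (h - t *: (1 + 'X)) x &
    x = -1 -> ('X - x%:P) ^+ 2 %| h - t *: (1 + 'X)].
  exists t, x; split=> //.
  have [xN1|xN1] := eqVneq x (-1); first by right; exact: gN1.
  have [x1|x1] := eqVneq x 1; first by left.
  right; apply: interior_min_zero_double => //; last by apply/eqP.
  by rewrite !lt_neqAle x1 eq_sym xN1.
(* If [h.[-1] = 0], factor [h = q (1 + X)] and let [t] be the minimum of [q]; a minimizer at [-1]
   then yields a second factor [1 + X]. *)
move: hN1; rewrite le_eqVlt => /predU1P[/esym/eqP hN1|hN1].
  have [q hq] := factor_theorem _ _ hN1.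
  have [x xI qmin] : exists2 c, c \in `[-1, 1] &
      forall y, y \in `[-1, 1] -> q.[c] <= q.[y].
    apply: (@EVT_min R (horner q)); first by lra.
        by apply: continuous_subspaceT; exact: continuous_horner.
  rewrite in_itv /= in xI.
  have gE : h - q.[x] *: (1 + 'X) = (q - q.[x]%:P) * ('X - (-1)%:P).
    by rewrite hq polyCN opprK mulrBl mul_polyC addrC [1 + 'X]addrC addrC.
  have q1 : 0 < q.[1].
    have := hgt0 1; rewrite hq hornerM hornerXsubC => H.
    by move: (H ltac:(lra)); rewrite pmulr_lgt0 //; lra.
  exists q.[x], x; rewrite gE; split=> //.
  (* A negative minimum, with [0 < q.[1]], would force a zero of [q], hence of [h], to the right of
     [x]. *)
  - rewrite leNgt; apply/negP => qx.
    have [y yI /eqP qy] : exists2 y, y \in `[x, 1] & root q y.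
      by apply: poly_ivt; lra.
    rewrite in_itv /= in yI.
    have yx : y != x by apply/eqP => yx; move: qy qx; rewrite yx => ->; lra.
    have := hgt0 y; rewrite hq hornerM qy mul0r ltxx => H; apply/notF/H.
    by move: yx xI yI; lra.
  - move=> y yI; rewrite hornerM hornerXsubC mulr_ge0 //; last by lra.
    by rewrite hornerD hornerN hornerC subr_ge0 qmin // in_itv.
  - by rewrite rootM rootE hornerD hornerN hornerC subrr eqxx.
  - move=> xN1; rewrite -xN1 expr2 dvdp_mul // dvdp_XsubCl rootE.
    by rewrite hornerD hornerN hornerC subrr.
have {}hgt0 (y : R) : -1 <= y <= 1 -> 0 < h.[y].
  by have [->//|yN1 yI] := eqVneq y (-1); apply: hgt0; move: yN1 yI; lra.
(* Here [t] is the minimum of [h.[y] / (1 + y)]; maximizing the reciprocal avoids the pole at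
   [-1]. *)
have [x xI qmax] : exists2 c, c \in `[-1, 1] &
    forall y, y \in `[-1, 1] -> (1 + y) / h.[y] <= (1 + c) / h.[c].
  apply: (@EVT_max R (fun y => (1 + y) / h.[y])); first by lra.
  apply: continuous_in_subspaceT => y; rewrite inE /= in_itv /= => yI.
  apply: cvgM; first by apply: cvgD; [exact: cvg_cst|exact: cvg_id].
  by apply: cvgV; [rewrite gt_eqF ?hgt0|exact: continuous_horner].
rewrite in_itv /= in xI.
have hx := hgt0 _ xI.
(* The maximum is at least the positive value at [1], so it is not attained at [-1]. *)
have x1 : 0 < 1 + x.
  have h1 : 0 < h.[1] by apply: hgt0; lra.
  have : 0 < (1 + x) / h.[x].
    apply: lt_le_trans (qmax 1 _); last by rewrite in_itv /=; lra.
    by rewrite divr_gt0.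
  by rewrite pmulr_lgt0 ?invr_gt0.
have gE y : (h - (h.[x] / (1 + x)) *: (1 + 'X)).[y] =
    h.[y] - h.[x] / (1 + x) * (1 + y).
  by rewrite !hornerE.
exists (h.[x] / (1 + x)), x; split=> //.
- by rewrite ltW // divr_gt0.
- move=> y yI; rewrite gE subr_ge0 mulrAC ler_pdivrMr //.
  have := qmax y; rewrite in_itv /= => /(_ yI).
  by rewrite ler_pdivrMr ?hgt0 // mulrAC ler_pdivlMr // => H; lra.
- by rewrite rootE gE divfK ?subrr // gt_eqF.
- by move=> xN1; move: x1; rewrite xN1; lra.
Qed.

(** * Effect of the subtraction on the coefficients and on [vfun] *)

Lemma ltr_sqrt_sub (R : rcfType) (p q t : R) : 0 < t -> t < q -> q < p ->
  Num.sqrt p - Num.sqrt q < Num.sqrt (p - t) - Num.sqrt (q - t).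
Proof.
move=> t0 tq qp.
have sp := @sqr_sqrtr R p ltac:(lra); have sq := @sqr_sqrtr R q ltac:(lra).
have sp' := @sqr_sqrtr R (p - t) ltac:(lra).
have sq' := @sqr_sqrtr R (q - t) ltac:(lra).
have pq : Num.sqrt q < Num.sqrt p by rewrite ltr_sqrt; lra.
have pp' : Num.sqrt (p - t) < Num.sqrt p by rewrite ltr_sqrt; lra.
have qq' : Num.sqrt (q - t) < Num.sqrt q by rewrite ltr_sqrt; lra.
have q'0 : 0 < Num.sqrt (q - t) by rewrite sqrtr_gt0; lra.
have p'0 : 0 < Num.sqrt (p - t) by rewrite sqrtr_gt0; lra.
(* Both differences are [p - q] divided by the sum of the two roots, and the shift by [t] shrinks
   that sum. *)
rewrite -(@ltr_pM2r _ (Num.sqrt (p - t) + Num.sqrt (q - t))); last by lra.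
rewrite -subr_sqr sp' sq'.
have -> : p - t - (q - t) =
    (Num.sqrt p - Num.sqrt q) * (Num.sqrt p + Num.sqrt q).
  by rewrite -subr_sqr sp sq; ring.
by rewrite ltr_pM2l; lra.
Qed.

(** Coefficients of [f(phi) - t (1 + cos phi)]. *)
Definition sub_1cos {R : realType} {n : nat} (a : 'I_n.+1 -> R) (t : R)
  (k : 'I_n.+1) : R := if (k <= 1)%N then a k - t else a k.

Section SubOneCos.
Variables (R : realType) (n : nat) (a : 'I_n.+1 -> R) (t : R).
Hypothesis n_gt0 : (0 < n)%N.

Let inord1 : (inord 1 : 'I_n.+1) = 1%N :> nat.
Proof. by rewrite inordK. Qed.

Lemma sum_sub_1cos (F : 'I_n.+1 -> R) :
  \sum_k sub_1cos a t k * F k =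
    \sum_k a k * F k - t * (F ord0 + F (inord 1)).
Proof.
have i1 : (inord 1 : 'I_n.+1) != ord0 by rewrite -val_eqE /= inord1.
have split2 (G : 'I_n.+1 -> R) : \sum_k G k = G ord0 + (G (inord 1) +
    \sum_(k | (k != ord0) && (k != inord 1)) G k).
  by rewrite (bigD1 ord0) //= (bigD1 (inord 1) i1).
rewrite !split2 /sub_1cos inord1 /=.
rewrite (eq_bigr (fun k => a k * F k)); first by ring.
move=> k /andP[k0 k1]; case: leqP => // k2; exfalso.
move: k0 k1 k2; rewrite -!val_eqE /= inord1.
by case: (nat_of_ord k) => [|[]].
Qed.

Lemma cospoly_sub_1cos phi :
  cospoly (sub_1cos a t) phi = cospoly a phi - t * (1 + cos phi).
Proof.
by rewrite /cospoly sum_sub_1cos mul0r cos0 inord1 mul1r.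
Qed.

Lemma algebraic_form_sub_1cos h : algebraic_form a h ->
  algebraic_form (sub_1cos a t) (h - t *: (1 + 'X)).
Proof.
move=> [sh hE]; split.
  apply: leq_trans (size_polyD _ _) _; rewrite size_polyN geq_max sh.
  apply: leq_trans (size_scale_leq _ _) _.
  by rewrite addrC -polyC1 size_XaddC.
by move=> phi; rewrite cospoly_sub_1cos hE !hornerE.
Qed.

Lemma vfun_sub_1cos : 0 < t -> t < a ord0 -> a ord0 < a (inord 1) ->
  (forall k, 0 <= a k) -> vfun (sub_1cos a t) < vfun a.
Proof.
move=> t0 ta0 a01 age0.
have i1 : (inord 1 : 'I_n.+1) != ord0 by rewrite -val_eqE /= inord1.
(* Since [t < a (inord 1)], this keeps the lowered numerator nonnegative, as multiplying the two
   strict inequalities requires. *)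
have a1 : a (inord 1) <= cospoly a 0 - a ord0.
  rewrite cospoly_at0 (bigD1 ord0) //= (bigD1 (inord 1) i1) /=.
  rewrite [a ord0 + _]addrC addrK.
  by rewrite lerDl sumr_ge0.
have sq := @ltr_sqrt_sub R (a (inord 1)) (a ord0) t t0 ta0 a01.
have sq0 : 0 < Num.sqrt (a (inord 1)) - Num.sqrt (a ord0).
  by rewrite subr_gt0 ltr_sqrt //; lra.
rewrite /vfun cospoly_sub_1cos cos0 /sub_1cos /= inord1 /=.
rewrite ltr_pdivrMr ?exprn_gt0 ?(lt_trans sq0) //.
rewrite mulrAC ltr_pdivlMr ?exprn_gt0 //.
apply: ltr_pM; rewrite ?exprn_ge0 ?ltW //; try lra.
by rewrite ltr_pXn2r // nnegrE ltW // (lt_trans sq0).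
Qed.

End SubOneCos.

Theorem theorem2p5 (R : realType) (n : nat) (hn : (2 <= n)%N)
    (f : 'I_n.+1 -> R) (hf : inC f) (hdr : ~ has_double_root f) :
  exists fbar : 'I_n.+1 -> R,
    inC fbar /\ has_double_root fbar /\ vfun f > vfun fbar.
Proof.
have n0 : (0 < n)%N := ltnW hn.
have inord1 : (inord 1 : 'I_n.+1) = 1%N :> nat by rewrite inordK.
case: hf => fge0 f0 f01 fpos.
have [h hform] := algebraic_form_exists f.
have hge0 (y : R) : -1 <= y <= 1 -> 0 <= h.[y].
  by move=> yI; have := fpos (acos y); rewrite hform.2 acosK ?in_itv.
have h1 : 0 < h.[1].
  rewrite -cos0 -hform.2 cospoly_at0 (bigD1 ord0) //= ltr_pwDl //.
  exact: sumr_ge0.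
have h0 : h != 0 by apply: contraTneq h1 => ->; rewrite horner0 ltxx.
(* An interior zero would be a double root of [f]; a simple zero at [-1] remains possible. *)
have hgt0 (y : R) : -1 < y <= 1 -> 0 < h.[y].
  move=> yI; rewrite lt_neqAle hge0 ?andbT; last by lra.
  have [->|y1] := eqVneq y 1; first by rewrite lt_eqF.
  apply/negP => /eqP hy; apply: hdr; exists y; split; first by lra.
  exists h; split=> //; rewrite mup_geq //; apply: interior_min_zero_double => //.
  by lra.
have hN1 : 0 <= h.[-1] by apply: hge0; lra.
have [t [x [t0 xI gge0 gx gx2]]] := sub_multiple_1X_touch _ h hN1 hgt0.
have gform := algebraic_form_sub_1cos _ _ f t n0 h hform.
set g := h - _ in gge0 gx gx2 gform.
set b := sub_1cos f t in gform.
have bpos phi : 0 <= cospoly b phi.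
  by rewrite gform.2 gge0 // cos_geN1 cos_le1.
have b01 : b ord0 < b (inord 1) by rewrite /b /sub_1cos /= inord1 /=; lra.
(* Positivity of [b ord0] comes in two stages: the weak bound makes every coefficient nonnegative
   and [b (inord 1)] positive, so [cospoly b 0] is positive, and this gives the strict bound. *)
have b0_ge0 : 0 <= b ord0.
  rewrite -(@pmulr_rge0 _ n.+1%:R) ?ltr0Sn // -mean_cospoly.
  exact: sumr_ge0.
have bge0 k : 0 <= b k.
  have [k1|k1] := leqP k 1; last by rewrite /b /sub_1cos leqNgt k1 /=.
  have [->//|k0] := eqVneq k ord0.
  suff -> : k = inord 1 by lra.
  apply/val_inj; rewrite /= inord1; move: k1 k0; rewrite -val_eqE /=.
  by case: (nat_of_ord k) => [|[]].
have b_at0 : 0 < cospoly b 0.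
  rewrite cospoly_at0 (bigD1 (inord 1)) //= ltr_pwDl //; first by lra.
  exact: sumr_ge0.
have b0 := cospoly_const_gt0 _ _ _ bpos b_at0.
have g1 : 0 < g.[1] by rewrite -cos0 -gform.2.
have g0 : g != 0 by apply: contraTneq g1 => ->; rewrite horner0 ltxx.
have dbl : has_double_root b.
  exists x; split=> //; exists g; split=> //; rewrite mup_geq //.
  by case: gx2 => // x1; move: gx g1; rewrite x1 rootE => /eqP ->; rewrite ltxx.
exists b; split; first by split.
split=> //; apply: vfun_sub_1cos => //.
- rewrite lt_neqAle t0 andbT; apply/eqP => t00; apply: hdr.
  suff -> : f = b by [].
  by apply/funext => k; rewrite /b /sub_1cos -t00 subr0 if_same.
- by move: b0; rewrite /b /sub_1cos /=; lra.
Qed.
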